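(* Let $S=\{x_1,x_2,\ldots,x_m\}$ be a gcd-closed set of distinct positive integers having an element $x$ with $|G_S(x)|\ge3$. If $D_S(x)$ is a divisor chain or $|D_S(x)|\le3$, then $(S)\nmid[S]$.
   Context: $S$ is gcd-closed if $\gcd(x,y)\in S$ for all $x,y\in S$. The GCD matrix $(S)$ is the $m\times m$ matrix with $(i,j)$-entry $\gcd(x_i,x_j)$; the LCM matrix $[S]$ has $(i,j)$-entry $\mathrm{lcm}(x_i,x_j)$. For $A,B\in M_m(\mathbb{Z})$, $A\mid B$ means there is $C\in M_m(\mathbb{Z})$ with $B=AC$ or $B=CA$; $A\nmid B$ otherwise. For $x<y$ in $S$, $x$ is a greatest-type divisor of $y$ in $S$ if $x\mid y$ and $x\mid z\mid y$, $z\in S$ imply $z\in\{x,y\}$; $G_S(y)$ is the set of greatest-type divisors of $y$ in $S$. If $G_S(x)=\{y_1,\ldots,y_k\}$, then $D_S(x)=\{\gcd(y_{i_1},\ldots,y_{i_r}): 2\le r\le k,\ 1\le i_1<\cdots<i_r\le k\}$. A divisor chain is a set totally ordered by divisibility. *)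

(* Defs.v *)
From mathcomp Require Import all_boot all_order all_algebra.

Set Implicit Arguments.
Unset Strict Implicit.
Unset Printing Implicit Defensive.

(* A finite set of integers {x_1, ..., x_m} is given by the m.-tuple (or, when
   m plays no role, the sequence) of its elements; that the x_i are distinct is
   the separate hypothesis [uniq S]. *)

Definition gcd_closed (S : seq nat) : Prop :=
  {in S &, forall x y, gcdn x y \in S}.

Definition gcd_matrix (m : nat) (S : m.-tuple nat) : 'M[int]_m :=
  \matrix_(i < m, j < m) Posz (gcdn (tnth S i) (tnth S j)).

Definition lcm_matrix (m : nat) (S : m.-tuple nat) : 'M[int]_m :=
  \matrix_(i < m, j < m) Posz (lcmn (tnth S i) (tnth S j)).

Definition mx_divides (m : nat) (A B : 'M[int]_m) : Prop :=
  exists C : 'M[int]_m, B = (A *m C)%R \/ B = (C *m A)%R.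

Definition greatest_type_divisor (S : seq nat) (x y : nat) : bool :=
  [&& x \in S, y \in S, x < y, x %| y &
      all (fun z => (x %| z) && (z %| y) ==> (z \in [:: x; y])) S].

(* Duplicate-free as soon as S is, so its size is then |G_S(x)|. *)
Definition GS (S : seq nat) (x : nat) : seq nat :=
  [seq y <- S | greatest_type_divisor S y x].

(* The index sets J = {i_1 < ... < i_r} with r >= 2; the neutral element 0 of
   gcdn plays no role since J is nonempty.  Duplicates are removed so that the
   size of the sequence is |D_S(x)|. *)
Definition DS (S : seq nat) (x : nat) : seq nat :=
  undup [seq \big[gcdn/0]_(i in J) nth 0 (GS S x) i |
          J : {set 'I_(size (GS S x))} in [pred J : {set _} | 2 <= #|J|]].

Definition divisor_chain (D : seq nat) : Prop := {in D &, total dvdn}.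

(* Main.v *)
(** Let y_1, ..., y_k be the greatest-type divisors of x.  Inclusion-exclusion
    over the y_i applied to gcd(s, -), for s in S, gives the sum alpha of
    phi(d) over the divisors d of x dividing no y_i when x | s, and 0 otherwise
    (then gcd(s, x) divides some y_i).  Applied to lcm(y, -), for y | x, it
    gives the sum beta of phi(d) over the divisors d of x dividing no
    lcm(y, y_i).  Divisibility of the matrices forces alpha | beta, while
    0 <= beta <= alpha.  If y does not divide some y_j, then d = lcm(y, y_j) is
    counted by alpha but not by beta, so beta = 0, and the term d = x shows
    that lcm(y, y_l) = x for some l.

    Taking y = gcd(y_i, y_j) when it does not divide every y_l, distributivity
    makes gcd(y_i, y_j), gcd(y_i, y_l), gcd(y_j, y_l) and gcd(y_i, y_j, y_l)
    four distinct elements of D_S(x), the first two being incomparable.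
    Otherwise all the pairwise gcds coincide, and taking y = y_1 with
    lcm(y_1, y_j) = x any third y_l equals that common gcd. *)

Require Import Defs.
From mathcomp Require Import all_boot all_order all_algebra cyclic.

Set Implicit Arguments.
Unset Strict Implicit.
Unset Printing Implicit Defensive.

Import Order.Theory GRing.Theory.

Lemma gcdn_lcmr a b c : gcdn a (lcmn b c) = lcmn (gcdn a b) (gcdn a c).
Proof. exact: (@meetUr _ natdvd). Qed.

Lemma lcmn_gcdr a b c : lcmn a (gcdn b c) = gcdn (lcmn a b) (lcmn a c).
Proof. exact: (@joinIr _ natdvd). Qed.

(* Alternating sum of f over the gcds of x with the members of a subfamily of
   l, each subfamily J having sign (-1)^#|J|. *)
Fixpoint incl_excl (f : nat -> int) (x : nat) (l : seq nat) : int :=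
  if l is y :: l' then (incl_excl f x l' - incl_excl f (gcdn x y) l')%R
  else f x.

(** The recursion evaluates [f] only at [x] and at gcds of [x] with members of [l], and these never
    leave a gcd-closed [S]. This lets matrix identities, known only on [S], pass through
    inclusion-exclusion. *)
Lemma eq_incl_excl (S : seq nat) f g x l :
  gcd_closed S -> {in S, f =1 g} -> x \in S -> {subset l <= S} ->
  incl_excl f x l = incl_excl g x l.
Proof.
move=> Sgcd fg; elim: l x => [|y l IHl] x xS lS /=; first exact: fg.
have lS' : {subset l <= S} by move=> z zl; apply: lS; rewrite inE zl orbT.
by rewrite !IHl //; apply: Sgcd => //; apply: lS; rewrite mem_head.
Qed.

Lemma incl_excl_sum m (c : 'I_m -> int) (f : 'I_m -> nat -> int) x l :
  incl_excl (fun n => \sum_(i < m) c i * f i n)%R x l =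
  (\sum_(i < m) c i * incl_excl (f i) x l)%R.
Proof.
elim: l x => [|y l IHl] x //=; rewrite !IHl -sumrB.
by apply: eq_bigr => i _; rewrite mulrBr.
Qed.

Lemma incl_excl_gcdn s x l :
  incl_excl (fun n => Posz (gcdn s n)) x l = incl_excl Posz (gcdn s x) l.
Proof. by elim: l x => [|y l IHl] x //=; rewrite !IHl gcdnA. Qed.

Lemma incl_excl_lcmn y x l :
  incl_excl (fun n => Posz (lcmn y n)) x l =
  incl_excl Posz (lcmn y x) (map (lcmn y) l).
Proof. by elim: l x => [|z l IHl] x //=; rewrite !IHl lcmn_gcdr. Qed.

Definition new_div (x : nat) (l : seq nat) (d : nat) : bool :=
  (d %| x) && all (fun z => ~~ (d %| z)) l.

(** Starts from Gauss's sum of totients over the divisors of [x]; each new [y] removes the divisors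
    of [gcdn x y]. The free bound [N] puts [x] and [gcdn x y] over one index range, so that the two
    sums can be subtracted. *)
Lemma incl_exclE N x l : 0 < x < N ->
  incl_excl Posz x l = Posz (\sum_(d < N | new_div x l d) totient d).
Proof.
rewrite /new_div; elim: l x => [|y l IHl] x /andP[x0 xN] /=.
  rewrite -{1}(sum_totient_dvd x) (big_ord_widen_cond N (dvdn^~ x)) //.
  congr Posz; apply: eq_bigl => d; rewrite andbT ltnS.
  by apply: andb_idr => /dvdn_leq; apply.
have gx : 0 < gcdn x y < N.
  by rewrite gcdn_gt0 x0 (leq_ltn_trans (dvdn_leq x0 (dvdn_gcdl x y))).
rewrite !IHl ?x0 // (bigID (fun d : 'I_N => d %| y)) /= PoszD.
rewrite [X in (X + _ - _)%R](_ : _ = Posz (\sum_(d < N |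
  (d %| gcdn x y) && all (fun z => ~~ (d %| z)) l) totient d)); last first.
  by congr Posz; apply: eq_bigl => d; rewrite dvdn_gcd andbAC.
rewrite addrC addKr; congr Posz; apply: eq_bigl => d.
by rewrite -andbA [_ && ~~ _]andbC.
Qed.

Section GreatestTypeDivisors.
Variables (S : seq nat) (x : nat).

Lemma mem_GS y : (y \in GS S x) = greatest_type_divisor S y x.
Proof. by rewrite mem_filter; apply: andb_idr; case/and5P. Qed.

Lemma GS_sub : {subset GS S x <= S}.
Proof. by move=> y; rewrite mem_filter => /andP[]. Qed.

Lemma GS_dvd y : y \in GS S x -> y %| x.
Proof. by rewrite mem_GS => /and5P[]. Qed.

Lemma GS_neq y : y \in GS S x -> y != x.
Proof. by rewrite mem_GS => /and5P[_ _ + _ _]; rewrite ltn_neqAle => /andP[]. Qed.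

Lemma GS_dvd_eq y z : y \in GS S x -> z \in GS S x -> y %| z -> y = z.
Proof.
move=> yG zG yz; move: (yG); rewrite mem_GS => /and5P[_ _ _ _ /allP].
move=> /(_ z (GS_sub zG)); rewrite yz GS_dvd //= !inE (negPf (GS_neq zG)) orbF.
by move/eqP.
Qed.

(** Climb from [s]: unless it is already of greatest type, some [z] in [S] lies strictly between [s]
    and [x], and [x - z] is smaller. *)
Lemma dvd_GS s : 0 < x -> x \in S -> s \in S -> s %| x -> s != x ->
  exists2 y, y \in GS S x & s %| y.
Proof.
move=> x0 xS; have [n le_n] := ubnP (x - s).
elim: n s le_n => // n IHn s le_n sS sx s_neq.
have s_lt : s < x by rewrite ltn_neqAle s_neq dvdn_leq.
have [sG | ] := boolP (s \in GS S x); first by exists s.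
rewrite mem_GS /greatest_type_divisor sS xS s_lt sx /= => /allPn[z zS].
rewrite negb_imply !inE negb_or => /andP[/andP[sz zx] /andP[zs z_neq]].
have lt_sz : s < z.
  by rewrite ltn_neqAle eq_sym zs dvdn_leq // (dvdn_gt0 x0 zx).
have [|y yG zy] := IHn z _ zS zx z_neq; last first.
  by exists y => //; apply: dvdn_trans zy.
by apply: leq_trans (ltn_sub2l s_lt lt_sz) _; rewrite -ltnS.
Qed.

Lemma DS_gcd (i j : 'I_(size (GS S x))) : i != j ->
  gcdn (nth 0 (GS S x) i) (nth 0 (GS S x) j) \in DS S x.
Proof.
move=> ij; rewrite mem_undup; apply/mapP; exists [set i; j].
  by rewrite mem_enum inE /= cards2 ij.
by rewrite big_setU1 ?big_set1 // inE.
Qed.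

Lemma DS_gcd3 (i j l : 'I_(size (GS S x))) : i != j -> i != l -> j != l ->
  gcdn (nth 0 (GS S x) i) (gcdn (nth 0 (GS S x) j) (nth 0 (GS S x) l))
    \in DS S x.
Proof.
move=> ij il jl; rewrite mem_undup; apply/mapP; exists (i |: [set j; l]).
  by rewrite mem_enum inE /= cardsU1 cards2 jl addnC.
by rewrite !big_setU1 ?big_set1 ?inE // negb_or ij.
Qed.

End GreatestTypeDivisors.

(** The coefficients form a column of the quotient matrix, or a row when it multiplies on the left;
    symmetry of both matrices merges the two cases. *)
Lemma mx_divides_lcmE m (S : m.-tuple nat) y :
  mx_divides (gcd_matrix S) (lcm_matrix S) -> y \in S ->
  exists c : 'I_m -> int, {in S, forall t,
    Posz (lcmn y t) = (\sum_(s < m) c s * Posz (gcdn (tnth S s) t))%R}.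
Proof.
case=> C SC /tnthP[i ->]; case: SC => SC.
  exists (fun s => C s i) => _ /tnthP[j ->].
  have := congr1 (fun A : 'M_m => A j i) SC; rewrite !mxE lcmnC => ->.
  by apply: eq_bigr => s _; rewrite !mxE mulrC gcdnC.
exists (fun s => C i s) => _ /tnthP[j ->].
have := congr1 (fun A : 'M_m => A i j) SC; rewrite !mxE => ->.
by apply: eq_bigr => s _; rewrite !mxE.
Qed.

Lemma mx_divides_lcm_GS m (S : m.-tuple nat) x y z :
    {in S, forall y, 0 < y} -> gcd_closed S ->
    mx_divides (gcd_matrix S) (lcm_matrix S) ->
    x \in S -> y \in S -> y %| x -> z \in GS S x -> ~~ (y %| z) ->
  exists2 w, w \in GS S x & lcmn y w = x.
Proof.
move=> Spos Sgcd div_S xS yS yx zG yNz; set l := GS S x in zG *.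
have x0 := Spos _ xS; have y0 := Spos _ yS.
have lcm_x w : w \in l -> lcmn y w %| x by move=> wl; rewrite dvdn_lcm yx (GS_dvd wl).
have lcm_lt w : w \in l -> lcmn y w < x.+1.
  by move=> wl; rewrite ltnS dvdn_leq // lcm_x.
pose alpha := \sum_(d < x.+1 | new_div x l d) totient d.
pose beta := \sum_(d < x.+1 | new_div x (map (lcmn y) l) d) totient d.
have gcd_ie s : s \in S -> incl_excl (fun n => Posz (gcdn s n)) x l =
    (Posz alpha * Posz (x %| s))%R.
  move=> sS; have gx := dvdn_gcdr s x.
  have gN : 0 < gcdn s x < x.+1 by rewrite gcdn_gt0 x0 orbT ltnS dvdn_leq.
  rewrite incl_excl_gcdn (incl_exclE _ gN) -PoszM; congr Posz.
  have [xs | xNs] := boolP (x %| s); first by rewrite (gcdn_idPr xs) muln1.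
  rewrite muln0 big_pred0 // => d.
  have gNx : gcdn s x != x by apply: contraNneq xNs => <-; apply: dvdn_gcdl.
  have [w wl gw] := dvd_GS x0 xS (Sgcd _ _ sS xS) gx gNx.
  apply/negP => /andP[dg /allP/(_ _ wl)].
  by rewrite (dvdn_trans dg gw).
have beta_ie : incl_excl (fun n => Posz (lcmn y n)) x l = Posz beta.
  have lcm_yx : lcmn y x = x by apply/lcmn_idPr.
  by rewrite incl_excl_lcmn lcm_yx (@incl_exclE x.+1) // x0 ltnSn.
have alpha_dvd : alpha %| beta.
  have [c cP] := mx_divides_lcmE div_S yS.
  have /esym := eq_incl_excl Sgcd cP xS (@GS_sub S x).
  (* By linearity each gcd term contributes [alpha] times [c s] or 0, so [beta] is an integer
     multiple of [alpha]. *)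
  rewrite beta_ie (incl_excl_sum c (fun s n => Posz (gcdn (tnth S s) n))).
  under eq_bigr => s _ do rewrite gcd_ie ?mem_tnth // mulrCA.
  rewrite -mulr_sumr => /(congr1 absz); rewrite abszM /= => <-.
  exact: dvdn_mulr.
have sub_new d : new_div x (map (lcmn y) l) d -> new_div x l d.
  case/andP=> dx /allP dN; rewrite /new_div dx; apply/allP => w wl.
  by apply: contra (dN _ (map_f _ wl)) => dw; apply: dvdn_trans dw (dvdn_lcmr _ _).
have beta_lt : beta < alpha.
  pose d0 := Ordinal (lcm_lt _ zG).
  have d0_old : ~~ new_div x (map (lcmn y) l) d0.
    by apply/negP => /andP[_ /allP/(_ _ (map_f _ zG))]; rewrite dvdnn.
  have d0_new : new_div x l d0.
    rewrite /new_div lcm_x //; apply/allP => w wl; apply/negP => dw.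
    (* A [w] divisible by [lcmn y z] is a multiple of [z], hence [z] itself, and then [y] divides
       [z]. *)
    have zw := GS_dvd_eq zG wl (dvdn_trans (dvdn_lcmr y z) dw).
    by case/negP: yNz; rewrite zw; apply: dvdn_trans dw; apply: dvdn_lcml.
  rewrite /alpha (bigD1 d0) //= -[X in X < _]add0n -addSn leq_add //.
    by rewrite totient_gt0 lcmn_gt0 y0 (Spos _ (GS_sub zG)).
  rewrite /beta big_mkcond [X in _ <= X]big_mkcond /=.
  apply: leq_sum => d _; case: ifP => // dn.
  rewrite sub_new //=; case: eqVneq => // dd0.
  by rewrite -dd0 dn in d0_old.
have beta0 : beta = 0.
  apply/eqP; rewrite -leqn0 leqNgt; apply: contraL beta_lt => b0.
  by rewrite -leqNgt dvdn_leq.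
have : ~~ new_div x (map (lcmn y) l) x.
  apply/negP => xnew; move/eqP: beta0; rewrite sum_nat_eq0.
  move/forall_inP/(_ (@ord_max x) xnew); apply/negP.
  by rewrite -lt0n totient_gt0.
rewrite /new_div dvdnn all_map => /allPn[w wl /negPn /= xw].
by exists w => //; apply/eqP; rewrite eqn_dvd lcm_x.
Qed.

Theorem theorem3p5 (m : nat) (S : m.-tuple nat)
    (S_uniq : uniq S) (S_pos : {in S, forall y, 0 < y})
    (S_gcd : gcd_closed S)
    (x : nat) (xS : x \in S) (x_GS : 3 <= size (GS S x))
    (x_DS : divisor_chain (DS S x) \/ size (DS S x) <= 3) :
  ~ mx_divides (gcd_matrix S) (lcm_matrix S).
Proof.
move=> div_S; set n := size (GS S x) in x_GS.
pose g (i : 'I_n) := nth 0 (GS S x) i.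
have gG i : g i \in GS S x by apply: mem_nth.
have gS i : g i \in S by apply: GS_sub (gG i).
have G_uniq : uniq (GS S x) by rewrite filter_uniq.
have g_dvd i j : g i %| g j -> i = j.
  move=> /(GS_dvd_eq (gG i) (gG j)) /eqP.
  by rewrite nth_uniq // => /eqP/val_inj.
have lcmP y j : y \in S -> y %| x -> ~~ (y %| g j) -> exists l, lcmn y (g l) = x.
  move=> yS yx yNg.
  have [_ /(nthP 0)[l ln <-] lx] :=
    mx_divides_lcm_GS S_pos S_gcd div_S xS yS yx (gG j) yNg.
  by exists (Ordinal ln).
have lcm_neq i l : lcmn (g i) (g l) = x -> i != l.
  move=> lx; apply/eqP => il; have := GS_neq (gG l).
  by rewrite -lx il (lcmn_idPl (dvdnn _)) eqxx.
have [all_dvd | ] := boolP [forall i, forall j, forall l,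
  (i != j) ==> (gcdn (g i) (g j) %| g l)].
  have gcd_dvd i j l : i != j -> gcdn (g i) (g j) %| g l.
    by move=> ij; move/'forall_'forall_'forall_implyP: all_dvd; apply.
  pose i0 : 'I_n := Ordinal (ltn_trans (isT : 0 < 2) x_GS).
  pose i1 : 'I_n := Ordinal (ltn_trans (isT : 1 < 2) x_GS).
  have [|j lx] := lcmP (g i0) i1 (gS _) (GS_dvd (gG _)).
    by apply/negP => /g_dvd /(congr1 val).
  have i0j := lcm_neq _ _ lx.
  have [l l0 lj] : exists2 l, l != i0 & l != j.
    have [j1 | j1] := eqVneq j i1; last by exists i1; rewrite // eq_sym.
    by exists (Ordinal x_GS); rewrite ?j1.
  (* Distributing [gcdn (g l) x] over [x = lcmn (g i0) (g j)] leaves two pairwise gcds, each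
     dividing [g i0]. *)
  have : g l %| g i0.
    rewrite -(gcdn_idPl (GS_dvd (gG l))) -lx gcdn_lcmr dvdn_lcm.
    by rewrite !gcd_dvd.
  by move/g_dvd/eqP; rewrite (negPf l0).
move=> /forallPn[i /forallPn[j /forallPn[k]]]; rewrite negb_imply => /andP[ij cNk].
have cS : gcdn (g i) (g j) \in S by apply: S_gcd.
have cx : gcdn (g i) (g j) %| x by apply: dvdn_trans (dvdn_gcdl _ _) (GS_dvd (gG i)).
have [l lx] := lcmP _ _ cS cx cNk.
have cNl : ~~ (gcdn (g i) (g j) %| g l).
  by apply/negP => /lcmn_idPr; rewrite lx => xl; have := GS_neq (gG l); rewrite xl eqxx.
have il : i != l by apply: contraNneq cNl => <-; apply: dvdn_gcdl.
have jl : j != l by apply: contraNneq cNl => <-; apply: dvdn_gcdr.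
have giE : g i = lcmn (gcdn (g i) (g j)) (gcdn (g i) (g l)).
  by rewrite -{1}(gcdn_idPl (GS_dvd (gG i))) -lx gcdn_lcmr gcdnA gcdnn.
have gjE : g j = lcmn (gcdn (g i) (g j)) (gcdn (g j) (g l)).
  rewrite -{1}(gcdn_idPl (GS_dvd (gG j))) -lx gcdn_lcmr.
  by rewrite [gcdn (g j) (gcdn _ _)]gcdnCA gcdnn.
(* Otherwise both lcm factors of [g i] in [giE] would divide [g j], against the incomparability of
   [g i] and [g j]. *)
have aNj : ~~ (gcdn (g i) (g l) %| g j).
  apply/negP => aj; case/eqP: ij; apply: g_dvd.
  by rewrite giE dvdn_lcm dvdn_gcdr.
have bNi : ~~ (gcdn (g j) (g l) %| g i).
  apply/negP => bi; case/eqP: ij; apply/esym/g_dvd.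
  by rewrite gjE dvdn_lcm dvdn_gcdl.
have cD : gcdn (g i) (g j) \in DS S x by apply: DS_gcd.
have aD : gcdn (g i) (g l) \in DS S x by apply: DS_gcd.
have bD : gcdn (g j) (g l) \in DS S x by apply: DS_gcd.
have eD : gcdn (g i) (gcdn (g j) (g l)) \in DS S x by apply: DS_gcd3.
case: x_DS => [chain | ].
  case/orP: (chain _ _ cD aD) => [ca | ac].
    by case/negP: cNl; apply: dvdn_trans ca (dvdn_gcdr _ _).
  by case/negP: aNj; apply: dvdn_trans ac (dvdn_gcdr _ _).
apply/negP; rewrite -ltnNge.
pose D4 := [:: gcdn (g i) (g j); gcdn (g i) (g l); gcdn (g j) (g l);
               gcdn (g i) (gcdn (g j) (g l))].
apply: (@uniq_leq_size _ D4); last first.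
  by move=> d; rewrite !inE => /or4P[]/eqP->.
rewrite /= !inE !negb_or !andbT.
(* Each of the six pairs is separated by one of [g l], [g j], [g i], which the second member divides
   and the first does not. *)
have neq_dvd a b c : ~~ (a %| c) -> b %| c -> a != b.
  by move=> aNc bc; apply: contraNneq aNc => ->.
rewrite (neq_dvd _ _ (g l)) ?dvdn_gcdr //.
rewrite (neq_dvd _ _ (g l)) ?dvdn_gcdr //.
rewrite (neq_dvd _ _ (g l)) ?(dvdn_trans (dvdn_gcdr _ _) (dvdn_gcdr _ _)) //.
rewrite (neq_dvd _ _ (g j)) ?dvdn_gcdl //.
rewrite (neq_dvd _ _ (g j)) ?(dvdn_trans (dvdn_gcdr _ _) (dvdn_gcdl _ _)) //.
by rewrite (neq_dvd _ _ (g i)) ?dvdn_gcdl.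
Qed.
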